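(* Let $p$ be an odd prime and let $G$ be a group with $|G|=p^n$ and $|Z(G)|=p^{n-2}$. Let $\Omega_1=Z(G)$ and let $B_1,\dots,B_{p+1}$ be the blocks of $G\setminus Z(G)$. For $V\subseteq G$, $$\zeta(G,V)=\begin{cases} K_{p^{n-2}}, & V=\Omega_1,\\ K_{p^{n-1}-p^{n-2}}, & V=B_k\ (1\leq k\leq p+1).\end{cases}$$ Moreover, $\zeta(G,G)=K_{p^{n-2}}\vee (p+1).K_{p^{n-1}-p^{n-2}}$. (Equalities of graphs are up to isomorphism.)
   Context: $Z(G)$ is the center of $G$ and $C_G(g)$ the centralizer of $g$ in $G$. The commuting graph $\zeta(G,V)$, for $V\subseteq G$, is the simple graph with vertex set $V$ in which two distinct vertices are adjacent if and only if they commute in $G$. The blocks $B_1,\dots,B_{p+1}$ are the distinct sets of the form $C_G(g)\setminus Z(G)$ with $g\in G\setminus Z(G)$; they partition $G\setminus Z(G)$ into $p+1$ sets of $p^{n-1}-p^{n-2}$ elements each. $K_m$ is the complete graph on $m$ vertices, $m.K_r$ is the disjoint union of $m$ copies of $K_r$, and $\Gamma_1\vee\Gamma_2$ is the join of two graphs with disjoint vertex sets (every vertex of $\Gamma_1$ is joined to every vertex of $\Gamma_2$). *)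

(* Defs.v *)
From mathcomp Require Import all_boot all_fingroup all_solvable.

Set Implicit Arguments.
Unset Strict Implicit.
Unset Printing Implicit Defensive.

Import GroupScope.

Record sgraph := SGraph {
  svertex :> finType;
  sedge : rel svertex;
  sedge_sym : symmetric sedge;
  sedge_irr : irreflexive sedge }.

Definition sgraph_iso (A B : sgraph) : Prop :=
  exists2 f : A -> B, bijective f &
    forall x y : A, sedge (f x) (f y) = sedge x y.

Section Complete.
Variable m : nat.
Definition complete_rel : rel 'I_m := fun i j => i != j.
Lemma complete_sym : symmetric complete_rel.
Proof. by move=> i j; rewrite /complete_rel eq_sym. Qed.
Lemma complete_irr : irreflexive complete_rel.
Proof. by move=> i; rewrite /complete_rel eqxx. Qed.
Definition complete_graph := SGraph complete_sym complete_irr.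
End Complete.

Section Copies.
Variables (m : nat) (A : sgraph).
(* The first component of a vertex is the index of the copy. *)
Definition copies_rel : rel ('I_m * A)%type :=
  fun u v => (u.1 == v.1) && sedge u.2 v.2.
Lemma copies_sym : symmetric copies_rel.
Proof. by move=> u v; rewrite /copies_rel eq_sym sedge_sym. Qed.
Lemma copies_irr : irreflexive copies_rel.
Proof. by move=> u; rewrite /copies_rel sedge_irr andbF. Qed.
Definition copies_graph := SGraph copies_sym copies_irr.
End Copies.

Section Join.
Variables A B : sgraph.
Definition join_rel : rel (A + B)%type := fun u v =>
  match u, v with
  | inl x, inl y => sedge x y
  | inr x, inr y => sedge x y
  | _, _ => true
  end.
Lemma join_sym : symmetric join_rel.
Proof. by move=> [x|x] [y|y] //=; apply: sedge_sym. Qed.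
Lemma join_irr : irreflexive join_rel.
Proof. by move=> [x|x] /=; apply: sedge_irr. Qed.
Definition join_graph := SGraph join_sym join_irr.
End Join.

Section CommutingGraph.
Variables (gT : finGroupType) (V : {set gT}).
(* For V \subset G with G : {group gT} this is zeta(G, V): the group law of G
   is that of gT, so the graph depends on V only. *)
Definition commuting_rel : rel {x : gT | x \in V} :=
  fun x y => (x != y) && (val x * val y == val y * val x).
Lemma commuting_sym : symmetric commuting_rel.
Proof.
by move=> x y; rewrite /commuting_rel eq_sym (eq_sym (val x * val y)).
Qed.
Lemma commuting_irr : irreflexive commuting_rel.
Proof. by move=> x; rewrite /commuting_rel eqxx. Qed.
Definition commuting_graph := SGraph commuting_sym commuting_irr.
End CommutingGraph.

Definition blocks (gT : finGroupType) (G : {group gT}) : {set {set gT}} :=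
  [set 'C_G[g] :\: 'Z(G) | g in G :\: 'Z(G)].

(* Main.v *)
Require Import Defs.
From mathcomp Require Import all_boot all_fingroup all_solvable.

(** If [g] is a noncentral element, then [Z(G) < C_G(g) < G] forces
    [C_G(g) / Z(G)] to have order [p], hence to be cyclic, so [C_G(g)] is abelian
    of order [p^(n-1)].  Thus two noncentral elements commute exactly when they
    have the same centraliser, i.e., lie in the same block, and the blocks
    partition [G \ Z(G)] into pieces of equal size. *)

Set Implicit Arguments.
Unset Strict Implicit.
Unset Printing Implicit Defensive.

Import GroupScope.
Local Open Scope nat_scope.

(** * Numbering finite sets and recognising graph isomorphisms *)

Section SetIndex.
Variables (T : finType) (m : nat) (i0 : 'I_m).

(* [i0] is a junk value, never reached when [x \in A] and [#|A| = m]. *)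
Definition set_index (A : {set T}) (x : T) : 'I_m :=
  insubd i0 (index x (enum A)).

Lemma set_index_inj (A : {set T}) :
  #|A| = m -> {in A &, injective (set_index A)}.
Proof.
move=> cardA x y Ax Ay /(congr1 val).
have ltA z : z \in A -> index z (enum A) < m.
  by move=> Az; rewrite -cardA cardE index_mem mem_enum.
rewrite !val_insubd !ltA // => /(congr1 (nth x (enum A))).
by rewrite !nth_index ?mem_enum.
Qed.

End SetIndex.

(** Equal cardinalities make the injection bijective, and irreflexivity of both graphs settles the
    case of equal vertices. *)
Lemma sgraph_iso_inj (A B : sgraph) (f : A -> B) :
    injective f -> #|A| = #|B| ->
    (forall x y : A, x != y -> sedge (f x) (f y) = sedge x y) ->
  sgraph_iso A B.
Proof.
move=> inj_f eqAB edge_f; exists f; first by apply: inj_card_bij; rewrite ?eqAB.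
move=> x y; have [-> | /edge_f //] := eqVneq x y.
by rewrite !sedge_irr.
Qed.

Lemma card_commuting_graph (gT : finGroupType) (V : {set gT}) :
  #|commuting_graph V| = #|V|.
Proof. by rewrite card_sig; apply: eq_card. Qed.

Lemma commuting_graph_complete (gT : finGroupType) (V : {set gT}) (m : nat) :
    0 < m -> #|V| = m -> {in V &, forall x y, commute x y} ->
  sgraph_iso (commuting_graph V) (complete_graph m).
Proof.
move=> m_gt0 cardV cVV.
pose f (x : commuting_graph V) : complete_graph m :=
  set_index (Ordinal m_gt0) V (val x).
have inj_f : injective f.
  by move=> x y /(set_index_inj cardV (valP x) (valP y))/val_inj.
apply: (sgraph_iso_inj inj_f) => [|x y neq_xy].
  by rewrite card_commuting_graph cardV card_ord.
rewrite /= /complete_rel (inj_eq inj_f) /commuting_rel neq_xy.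
by apply/esym/eqP; apply: cVV; apply: valP.
Qed.

(** * Centralizers of noncentral elements *)

Section SmallCentralQuotient.
Variables (p k : nat) (gT : finGroupType) (G : {group gT}).
Hypotheses (p_prime : prime p) (cardG : #|G| = p ^ k.+2).
Hypothesis cardZ : #|'Z(G)| = p ^ k.

Lemma center_proper_subcent1 g :
  g \in G :\: 'Z(G) -> 'Z(G) \proper 'C_G[g].
Proof.
rewrite inE => /andP[ZNg Gg]; apply/properP; split.
  apply/subsetP=> z Zz; rewrite inE (subsetP (center_sub G)) //=.
  by apply/cent1P/commute_sym; apply: (centerC Gg Zz).
by exists g; rewrite // inE Gg cent1id.
Qed.

Lemma subcent1_proper g : g \in G :\: 'Z(G) -> 'C_G[g] \proper G.
Proof.
rewrite inE => /andP[ZNg Gg]; rewrite properE subsetIl /=.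
apply: contra ZNg; rewrite subsetI subxx /= => sGC.
by rewrite inE Gg -sub_cent1.
Qed.

(** By Lagrange the order is a power [p ^ e], and the two proper inclusions give [k < e < k.+2]. *)
Lemma card_subcent1 g : g \in G :\: 'Z(G) -> #|'C_G[g]| = p ^ k.+1.
Proof.
move=> Gg; have := cardSg (subsetIl G 'C[g]).
rewrite cardG => /(dvdn_pfactor _ _ p_prime)[e _ cardC].
have := proper_card (center_proper_subcent1 Gg).
have := proper_card (subcent1_proper Gg).
rewrite cardC cardG cardZ !ltn_exp2l ?prime_gt1 // => lt_e_k2 lt_k_e.
by congr (p ^ _); apply/eqP; rewrite eqn_leq lt_k_e -ltnS lt_e_k2.
Qed.

Lemma subcent1_abelian g : g \in G :\: 'Z(G) -> abelian 'C_G[g].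
Proof.
move=> Gg; have /andP[sZC _] := center_proper_subcent1 Gg.
have sZZC : 'Z(G) \subset 'Z('C_G[g]).
  by rewrite subsetI sZC (subset_trans (subsetIr _ _)) ?centS ?subsetIl.
apply: (cyclic_factor_abelian sZZC); apply: prime_cyclic.
have nZC : 'C_G[g] \subset 'N('Z(G)).
  by rewrite (subset_trans (subsetIl _ _)) ?gFnorm.
(* The quotient has order [p ^ k.+1 %/ p ^ k], which is the prime [p]. *)
rewrite card_quotient // -divgS // card_subcent1 // cardZ expnS.
by rewrite mulnK // expn_gt0 prime_gt0.
Qed.

(** If [h] lies in the abelian group ['C_G[g]], that group is contained in ['C_G[h]]; equal orders
    then force equality. *)
Lemma subcent1_eq g h :
    g \in G :\: 'Z(G) -> h \in G :\: 'Z(G) ->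
  (h \in 'C_G[g]) = ('C_G[h] == 'C_G[g]).
Proof.
move=> Gg Gh; apply/idP/eqP => [Cgh | <-]; last first.
  by case/setDP: Gh => Gh _; rewrite inE Gh cent1id.
apply/esym/eqP; rewrite eqEcard !card_subcent1 // leqnn andbT subsetI subsetIl.
by rewrite sub_cent1 (subsetP (subcent1_abelian Gg)).
Qed.

(** * Blocks: size, partition and number *)

Definition block (g : gT) : {set gT} := 'C_G[g] :\: 'Z(G).

Lemma mem_block g : g \in G :\: 'Z(G) -> g \in block g.
Proof. by case/setDP=> Gg ZNg; rewrite in_setD in_setI ZNg Gg cent1id. Qed.

Lemma block_sub g : block g \subset G :\: 'Z(G).
Proof. by rewrite setSD ?subsetIl. Qed.

Lemma block_in g : g \in G :\: 'Z(G) -> block g \in blocks G.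
Proof. exact: imset_f. Qed.

Lemma card_block g : g \in G :\: 'Z(G) -> #|block g| = p ^ k.+1 - p ^ k.
Proof.
move=> Gg; have /andP[sZC _] := center_proper_subcent1 Gg.
by rewrite cardsD (setIidPr sZC) card_subcent1 // cardZ.
Qed.

Lemma blocks_uniform :
  {in blocks G, forall B : {set gT}, #|B| = p ^ k.+1 - p ^ k}.
Proof. by move=> _ /imsetP[g Gg ->]; apply: card_block. Qed.

Lemma block_eq g h :
  g \in G :\: 'Z(G) -> h \in block g -> block h = block g.
Proof.
move=> Gg Bh; have Gh := subsetP (block_sub g) h Bh.
have /setDP[Cgh _] := Bh.
by move: Cgh; rewrite subcent1_eq // /block => /eqP->.
Qed.

Lemma block_commute g h :
    g \in G :\: 'Z(G) -> h \in G :\: 'Z(G) ->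
  (g * h == h * g)%g = (block g == block h).
Proof.
move=> Gg Gh; apply/eqP/eqP => [cgh | eqB].
  case/setDP: Gg => Gg ZNg; apply: block_eq => //.
  by apply/setDP; split=> //; apply/setIP; split=> //; apply/cent1P.
have := mem_block Gg; rewrite eqB => /setDP[/setIP[_ /cent1P cgh] _].
exact: cgh.
Qed.

Lemma blocks_partition : partition (blocks G) (G :\: 'Z(G)).
Proof.
apply/and3P; split.
- rewrite eqEsubset; apply/andP; split.
    by apply/bigcupsP=> _ /imsetP[g _ ->]; apply: block_sub.
  apply/subsetP=> g Gg; apply/bigcupP.
  by exists (block g); rewrite ?block_in ?mem_block.
(* Two blocks with a common element [x] both equal [block x]. *)
- apply/trivIsetP=> _ _ /imsetP[g Gg ->] /imsetP[h Gh ->]; apply: contraR.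
  case/pred0Pn=> x /andP[/= Bgx Bhx].
  by apply/eqP; rewrite -[LHS](block_eq Gg Bgx); apply: block_eq.
- apply/imsetP=> -[g /mem_block Bg eq0].
  by move: Bg; rewrite /block -eq0 inE.
Qed.

Lemma block_size_gt0 : 0 < p ^ k.+1 - p ^ k.
Proof. by rewrite subn_gt0 ltn_exp2l ?prime_gt1. Qed.

Lemma card_blocks : #|blocks G| = p + 1.
Proof.
have := card_uniform_partition blocks_uniform blocks_partition.
rewrite cardsD (setIidPr (center_sub G)) cardG cardZ => eq_card.
(* After multiplying by the block size and factoring out [p ^ k], what remains is
   [p ^ 2 - 1 = (p - 1) * (p + 1)]. *)
apply/eqP; rewrite -(eqn_pmul2r block_size_gt0) -eq_card.
rewrite !expnS -{2 4}[p ^ k]mul1n mulnA -!mulnBl mulnA; apply/eqP.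
by congr (_ * _); rewrite mulnC -[in LHS](exp1n 2) !mulnn subn_sqr.
Qed.

(** * The commuting graphs *)

Lemma blocks_commutative (B : {set gT}) :
  B \in blocks G -> {in B &, forall x y, commute x y}.
Proof.
case/imsetP=> g Gg -> x y /setDP[Cx _] /setDP[Cy _].
exact: (centsP (subcent1_abelian Gg)).
Qed.

Lemma blocks_complete (B : {set gT}) :
  B \in blocks G ->
  sgraph_iso (commuting_graph B) (complete_graph (p ^ k.+1 - p ^ k)).
Proof.
move=> blB; apply: commuting_graph_complete (blocks_commutative blB).
  exact: block_size_gt0.
exact: blocks_uniform.
Qed.

Lemma center_complete :
  sgraph_iso (commuting_graph 'Z(G)) (complete_graph (p ^ k)).
Proof.
apply: commuting_graph_complete; rewrite ?expn_gt0 ?prime_gt0 //.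
by move=> x y Zx Zy; apply: (centsP (center_abelian G)).
Qed.

Lemma commuting_graph_join :
  sgraph_iso (commuting_graph G)
    (join_graph (complete_graph (p ^ k))
       (copies_graph (p + 1) (complete_graph (p ^ k.+1 - p ^ k)))).
Proof.
set J := join_graph _ _.
have Z_gt0 : 0 < p ^ k by rewrite expn_gt0 prime_gt0.
have P_gt0 : 0 < p + 1 by rewrite addn1.
pose zi := set_index (Ordinal Z_gt0) 'Z(G).
pose bi := set_index (Ordinal P_gt0) (blocks G).
pose ei := set_index (Ordinal block_size_gt0).
(* A central element goes to its number in the center; a noncentral one goes to the number of its
   block, paired with its position inside that block. *)
pose f (x : commuting_graph G) : J :=
  if val x \in 'Z(G) then inl (zi (val x))
  else inr (bi (block (val x)), ei _ (block (val x)) (val x)).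
have noncentral (x : commuting_graph G) :
  val x \notin 'Z(G) -> val x \in G :\: 'Z(G).
  by move=> ZNx; apply/setDP; split; first exact: (valP x).
have inj_zi : {in 'Z(G) &, injective zi} by apply: set_index_inj.
have inj_bi : {in blocks G &, injective bi}.
  by apply: set_index_inj; apply: card_blocks.
have inj_f : injective f.
  move=> x y; rewrite /f.
  case: ifPn => [Zx | /noncentral Gx]; case: ifPn => [Zy | /noncentral Gy] //.
    by case=> /inj_zi eq_xy; apply: val_inj; apply: eq_xy.
  (* Equal first components give a common block, in which equal positions give equal elements. *)
  case=> /(inj_bi _ _ (block_in Gx) (block_in Gy)) eqB.
  rewrite eqB => /(set_index_inj (card_block Gy)) eq_xy; apply: val_inj.
  by apply: eq_xy; rewrite -?eqB ?mem_block // eqB mem_block.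
apply: (sgraph_iso_inj inj_f) => [|x y neq_xy].
  rewrite card_commuting_graph card_sum card_prod !card_ord cardG.
  rewrite -card_blocks.
  rewrite -(card_uniform_partition blocks_uniform blocks_partition) -cardZ -cardG.
  by rewrite -(cardsID 'Z(G) G) (setIidPr (center_sub G)).
(* Adjacency in a complete graph is distinctness of the indices, which is read off from
   [f x != f y]. *)
have: f x != f y by rewrite (inj_eq inj_f).
rewrite /= /commuting_rel neq_xy /f.
case: ifPn => [Zx | /noncentral Gx]; case: ifPn => [Zy | /noncentral Gy] //=.
- move=> neq_f; rewrite /complete_rel (centerC (valP x) Zy) eqxx.
  exact: neq_f.
- by move=> _; rewrite -(centerC (valP y) Zx) eqxx.
- by move=> _; rewrite (centerC (valP x) Zy) eqxx.
(* For two noncentral elements, commuting means lying in the same copy; there the positions differ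
   because the images do. *)
move=> neq_f; rewrite block_commute // /copies_rel /=.
rewrite (inj_in_eq inj_bi) ?block_in //.
have [eqB | //] := eqVneq (block (val x)) (block (val y)).
move: neq_f; rewrite eqB /complete_rel /=.
by apply: contraNneq => ->.
Qed.

End SmallCentralQuotient.

(** The count of [blocks G] is part of the conclusion because the indexing of the blocks from 1 to
    [p + 1] presupposes it. *)
Theorem proposition3p1 (p n : nat) (gT : finGroupType) (G : {group gT})
    (p_prime : prime p) (p_odd : odd p) (n_ge2 : 2 <= n)
    (cardG : #|G| = p ^ n) (cardZ : #|'Z(G)%g| = p ^ (n - 2)) :
  [/\ sgraph_iso (commuting_graph 'Z(G)%g) (complete_graph (p ^ (n - 2))),
      #|blocks G| = p + 1,
      forall B : {set gT}, B \in blocks G ->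
        sgraph_iso (commuting_graph B)
                   (complete_graph (p ^ (n - 1) - p ^ (n - 2)))
    & sgraph_iso (commuting_graph G)
        (join_graph (complete_graph (p ^ (n - 2)))
           (copies_graph (p + 1)
              (complete_graph (p ^ (n - 1) - p ^ (n - 2)))))].
Proof.
(* Writing [n] as [k.+2] turns the truncated differences [n - 1] and [n - 2] into [k.+1] and [k]. *)
case: n n_ge2 cardG cardZ => [|[|k]] // _.
rewrite subn1 subn2 /= => cardG cardZ; split.
- exact: center_complete.
- exact: card_blocks cardZ.
- exact: blocks_complete.
- exact: commuting_graph_join.
Qed.
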